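(* For every $n\ge1$, $$\hat x(z)^{\odot n}=\sum_{j=0}^{[n/2]}\frac1{j!}\binom{n}{2,\dots,2,n-2j}\frac{1}{(4z^2)^j}:\hat x(z)^{n-2j}:,$$ where $\binom{n}{2,\dots,2,n-2j}=\frac{n!}{2^j(n-2j)!}$ is the multinomial coefficient with $j$ entries equal to $2$.
   Context: Let $\tilde u_0,\tilde u_1,\dots$ be formal variables. For $k\ge0$ define operators on polynomials in the $\tilde u_i$: $\beta_{-(2k+1)}=(2k+1)\tilde u_k\,\cdot$ (multiplication; creators) and $\beta_{2k+1}=\frac{\partial}{\partial\tilde u_k}$ (annihilators). Let $\hat x(z)=-\sum_{m\in\mathbb Z}\beta_{2m+1}z^{-m-3/2}$. The normally ordered product $:\ :$ places all annihilators to the right of all creators; in particular $:\hat x(z)^0:\,=1$. One has $\hat x(z)\hat x(w)=\,:\hat x(z)\hat x(w):+\langle\hat x(z)\hat x(w)\rangle$ with $\langle\hat x(z)\hat x(w)\rangle=\frac{z+w}{\sqrt{zw}(z-w)^2}$, so $\langle\hat x(z+\epsilon)\hat x(z)\rangle=\frac{2z+\epsilon}{\sqrt{z(z+\epsilon)}\,\epsilon^2}=\frac2{\epsilon^2}+\frac1{4z^2}-\frac{\epsilon}{4z^3}+\cdots$. Regularized powers are defined inductively by $\hat x(z)^{\odot1}=\hat x(z)$ and $\hat x(z)^{\odot n}=\hat x(z)\odot\hat x(z)^{\odot(n-1)}$. Here, for a combination $A(z)$ of normally ordered powers $:\hat x(z)^k:$ with coefficients in $\mathbb C[z^{-1}]$,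 $\hat x(z)\odot A(z)$ is obtained by expanding the product $\hat x(z+\epsilon)A(z)$ using $$\hat x(z+\epsilon)\,:\hat x(z)^k:\;=\;:\hat x(z+\epsilon)\hat x(z)^k:+k\,\langle\hat x(z+\epsilon)\hat x(z)\rangle:\hat x(z)^{k-1}:,$$ removing the terms that are singular (negative powers of $\epsilon$) as $\epsilon\to0$, and then letting $\epsilon\to0$. *)

(* Defs.v *)
From HB Require Import structures.
From mathcomp Require Import all_boot all_order all_algebra.
From mathcomp Require Import finmap.
From mathcomp Require Import all_classical all_reals.
From mathcomp.real_closed Require Import complex.
(* The notations of monalg are incompatible with those of all_classical. *)
From mathcomp.multinomials Require Import -(notations) monalg.

Set Implicit Arguments.
Unset Strict Implicit.
Unset Printing Implicit Defensive.

Import Order.TTheory GRing.Theory Num.Theory.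

Local Open Scope classical_set_scope.
Local Open Scope ring_scope.

(** Polynomials over [K] in the variables u_0, u_1, ... *)
Notation fock K := (malg (cmonom nat) K).

Section Operators.
Variable K : numFieldType.

Definition uvar (k : nat) : fock K := mkmalgU (ucm k) 1.

(* [divcm] is truncated, but it is only truncated on monomials that do not
   contain u_k, whose coefficient here is 0. *)
Definition pderiv (k : nat) (p : fock K) : fock K :=
  \sum_(m <- msupp p) mkmalgU (divcm m (ucm k)) (mcoeff m p *+ m k).

(** [beta m] is the operator beta_{2m+1}; recall [Negz k] = - (k + 1), so that
    [2 * Negz k + 1 = - (2k + 1)]. *)
Definition beta (m : int) (p : fock K) : fock K :=
  match m with
  | Posz k => pderiv k p
  | Negz k => (2 * k + 1)%:R *: (uvar k * p)
  end.

(** [nord [:: m_1; ...; m_k]] is : beta_{2m_1+1} ... beta_{2m_k+1} : *)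
Definition nord (s : seq int) (p : fock K) : fock K :=
  foldr beta p ([seq m <- s | m < 0] ++ [seq m <- s | 0 <= m]).

(** Formal series in half-integral powers of z whose coefficients are operators:
    [A e] is the coefficient of z^(e/2). *)
Definition opseries := int -> fock K -> fock K.

Definition zmul (d : int) (A : opseries) : opseries := fun e => A (e - d).

(** In x(z), the mode beta_{2m+1} comes with z^(-m-3/2) = z^(zexp m / 2). *)
Definition zexp (m : int) : int := - (2 * m) - 3.

Definition xhat : opseries := fun e p =>
  - \sum_(m \in [set m | zexp m = e]) beta m p.

(** [xpow k] is :x(z)^k:. Applied to a given polynomial, only finitely many
    terms of the sum are nonzero. *)
Definition xpow (k : nat) : opseries := fun e p =>
  (-1) ^+ k *:
    \sum_(t \in [set t : k.-tuple int | \sum_(m <- t) zexp m = e]) nord t p.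

Definition gbinom (a : K) (j : nat) : K := (\prod_(i < j) (a - i%:R)) / j`!%:R.

(** Coefficient of eps^i z^(d/2) in the expansion of (z + eps)^(a/2) in
    nonnegative powers of eps. *)
Definition shifted_power (a i d : int) : K :=
  if i is Posz j then
    if d == a - 2 * i then gbinom (a%:~R / 2) j else 0
  else 0.

(** Coefficient of eps^i in :x(z + eps) x(z)^k:. *)
Definition xpow_shift (k : nat) (i : int) : opseries := fun e p =>
  (-1) ^+ k.+1 *:
    \sum_(mt \in [set: int * k.-tuple int])
      shifted_power (zexp mt.1) i (e - \sum_(m <- mt.2) zexp m)
        *: nord (mt.1 :: mt.2) p.

(** Coefficient of eps^i z^(d/2) in
    <x(z + eps) x(z)> = (2z + eps) z^(-1/2) (z + eps)^(-1/2) eps^(-2). *)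
Definition contraction (i d : int) : K :=
  2 * shifted_power (-1) (i + 2) (d - 1) + shifted_power (-1) (i + 1) (d + 1).

(** Coefficient of eps^i in <x(z + eps) x(z)> A(z). *)
Definition contraction_mul (i : int) (A : opseries) : opseries := fun e p =>
  \sum_(d \in [set: int]) contraction i d *: A (e - d) p.

(** Coefficient of eps^i in x(z + eps) :x(z)^k:, a Laurent series in eps. *)
Definition wick (k : nat) (i : int) : opseries := fun e p =>
  xpow_shift k i e p + k%:R *: contraction_mul i (xpow k.-1) e p.

(** The sum of the a_k(z) F_k(z), where [a`_k] represents a_k(z) in K[z^-1]:
    the variable ['X] of the inner polynomials stands for z^-1. *)
Definition zcomb (a : {poly {poly K}}) (F : nat -> opseries) : opseries :=
  fun e p => \sum_(k < size a) \sum_(j < size a`_k)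
    a`_k`_j *: zmul (- (2 * j%:Z)) (F k) e p.

(** Coefficient of eps^i in x(z + eps) A(z), where A(z) is the combination
    [zcomb a xpow] of normally ordered powers. *)
Definition xhat_mul (a : {poly {poly K}}) (i : int) : opseries :=
  zcomb a (fun k => wick k i).

(** [odot A B] : A(z) is a combination of normally ordered powers, and B(z) is
    the regularized product of x(z) with A(z). Once the negative powers of eps
    are removed, the limit eps -> 0 is the coefficient of eps^0. *)
Definition odot (A B : opseries) : Prop :=
  exists a : {poly {poly K}}, A = zcomb a xpow /\ B = xhat_mul a 0.

(** [xhat_odot n A] : A(z) is the n-th regularized power of x(z). *)
Inductive xhat_odot : nat -> opseries -> Prop :=
| xhat_odot1 : xhat_odot 1 xhat
| xhat_odotS n A B : xhat_odot n A -> odot A B -> xhat_odot n.+1 B.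

End Operators.

(* Main.v *)
Require Import Defs.
From mathcomp Require Import all_boot all_order all_algebra.
From mathcomp Require Import finmap.
From mathcomp Require Import all_classical all_reals.
From mathcomp.real_closed Require Import complex.
From mathcomp.multinomials Require Import -(notations) monalg.
From mathcomp Require Import zify ring.

(** Write X^k for :x(z)^k:, so that a combination of normally ordered powers
    becomes a polynomial a in X over K[z^-1]. At order eps^0, the product
    x(z + eps) X^k consists of X^(k+1), coming from :x(z + eps) x(z)^k:, and of
    k X^(k-1) times z^-2 / 4, the constant term of <x(z + eps) x(z)>.
    Hence the regularized product by x(z) is the operator
      a |-> a X + (z^-2 / 4) a'(X)        ([xhat_step], [xhat_mul0])
    on polynomials. Starting from X^0 = 1, its iterates are rescaled Hermite
    polynomials, and the claimed sum is their classical closed form: the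
    recurrence on coefficients ([regpow_coefS]) comes down to the identity
    (n+1)^_(m+1) = n^_(m+1) + (m+1) n^_m between falling factorials.

    The regularized product is defined as a relation on operator-valued series:
    a series may be multiplied through any expression of it as a combination of
    normally ordered powers. For the regularized powers to be unique, such an
    expression has to be unique ([zcomb_xpow_inj]). This is seen on the
    vacuum 1. An annihilator kills 1, so :x(z)^k: 1 is the k-th power of the
    creation part of x(z), homogeneous of degree k in the u_i; since u_0 comes
    with z^(-1/2), its coefficient at u_0^k is (-1)^k z^(-k/2), while no other
    :x(z)^l: 1 contains the monomial u_0^k. The coefficient of u_0^k z^(-k/2-j)
    in a(z) applied to 1 is thus, up to sign, the coefficient of z^-j X^k in a
    ([mcoeff_zcomb_xpow_vacuum]). *)

Import Order.TTheory GRing.Theory Num.Theory.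
Local Open Scope ring_scope.

Set Implicit Arguments.
Unset Strict Implicit.
Unset Printing Implicit Defensive.

(** * Additive functions of polynomials *)

Section CoefSum.
Variables (R : nzRingType) (V : zmodType) (f : nat -> R -> V).
Hypothesis fD : forall k, {morph f k : x y / x + y}.

Let f0 k : f k 0 = 0.
Proof. by apply: (@addrI _ (f k 0)); rewrite -fD !addr0. Qed.

Lemma coef_sum_widen (a : {poly R}) N : (size a <= N)%N ->
  \sum_(k < size a) f k a`_k = \sum_(k < N) f k a`_k.
Proof.
move=> aN; rewrite (big_ord_widen N (fun k => f k a`_k)) // big_mkcond /=.
by apply: eq_bigr => k _; case: ltnP => // ak; rewrite nth_default.
Qed.

Lemma coef_sumD :
  {morph (fun a : {poly R} => \sum_(k < size a) f k a`_k) : a b / a + b}.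
Proof.
move=> a b; pose N := maxn (size a) (size b).
rewrite !(@coef_sum_widen _ N) ?leq_maxl ?leq_maxr ?size_polyD //.
by rewrite -big_split; apply: eq_bigr => k _; rewrite coefD fD.
Qed.

Lemma coef_sumZXn c k :
  \sum_(i < size (c *: 'X^k : {poly R})) f i (c *: 'X^k : {poly R})`_i = f k c.
Proof.
rewrite (@coef_sum_widen _ k.+1); last first.
  by rewrite (leq_trans (size_scale_leq _ _)) ?size_polyXn.
rewrite big_ord_recr big1 /= ?add0r => [|i _].
  by rewrite coefZ coefXn eqxx mulr1.
by rewrite coefZ coefXn (ltn_eqF (ltn_ord i)) mulr0 f0.
Qed.

End CoefSum.

Lemma additive_sum (U V : zmodType) (f : U -> V) (I : Type) (r : seq I)
    (F : I -> U) : {morph f : x y / x + y} ->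
  f (\sum_(i <- r) F i) = \sum_(i <- r) f (F i).
Proof.
move=> fD; apply: big_morph => //.
by apply: (@addrI _ (f 0)); rewrite -fD !addr0.
Qed.

(** The operators below act on {poly {poly K}} through sums whose bounds depend
    on the sizes of the polynomials. Reducing to monomials avoids comparing
    these bounds. *)
Lemma additive_bipoly_ext (K : nzRingType) (V : zmodType)
    (f g : {poly {poly K}} -> V) :
  {morph f : a b / a + b} -> {morph g : a b / a + b} ->
  (forall c j k, f ((c *: 'X^j) *: 'X^k) = g ((c *: 'X^j) *: 'X^k)) ->
  f =1 g.
Proof.
move=> fD gD fg a; rewrite -[a]coefK poly_def !additive_sum //.
apply: eq_bigr => k _; rewrite -[a`_k]coefK poly_def scaler_suml.
by rewrite !additive_sum //; apply: eq_bigr => j _; exact: fg.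
Qed.

Section RegularizedPowers.
Variable K : numFieldType.

Section Zcomb.
Variables (F : nat -> opseries K) (e : int) (p : fock K).

Let term k j (x : K) := x *: zmul (- (2 * j%:Z)) (F k) e p.
Let coefficient k (q : {poly K}) := \sum_(j < size q) term k j q`_j.

Let termD k j : {morph term k j : x y / x + y}.
Proof. by move=> x y; rewrite /term scalerDl. Qed.

Let coefficientD k : {morph coefficient k : q r / q + r}.
Proof. exact: coef_sumD (termD k). Qed.

Lemma zcombD : {morph (fun a => zcomb a F e p) : a b / a + b}.
Proof. exact: coef_sumD coefficientD. Qed.

Lemma zcomb_monomial c j k :
  zcomb ((c *: 'X^j) *: 'X^k) F e p = c *: zmul (- (2 * j%:Z)) (F k) e p.
Proof.
by rewrite [LHS](coef_sumZXn coefficientD) [LHS](coef_sumZXn (termD k)).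
Qed.

End Zcomb.

(** * The regularized product by x(z) as an operator on polynomials *)

Lemma xpow1 : xpow 1 = xhat (K := K).
Proof.
apply/funext => e; apply/funext => p.
rewrite /xpow /xhat expr1 scaleN1r; congr (- _).
pose modes : set int := [set m | zexp m = e]%classic.
rewrite (@reindex_fsbig _ _ _ _ _ (fun m => [tuple m]) modes).
  by apply: eq_fsbigr => m _; rewrite /nord /=; case: m.
split=> [m /= <-|m m' _ _ /(congr1 val) []//|t /=].
  by rewrite big_seq1.
by case/tupleP: t => m t; rewrite tuple0 big_seq1 => me; exists m => //;
  exact/val_inj.
Qed.

Lemma shifted_power0 a d : shifted_power K a 0 d = (d == a)%:R.
Proof.
rewrite /shifted_power mulr0 subr0 /= /gbinom big_ord0 fact0 divr1.
by case: eqP.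
Qed.

(** At eps = 0 the operator x(z + eps) is x(z): the extra mode of
    :x(z + eps) x(z)^k: becomes the head of a (k+1)-tuple of modes. *)
Lemma xpow_shift0 k : xpow_shift k 0 = xpow (K := K) k.+1.
Proof.
apply/funext => e; apply/funext => p; congr (_ *: _).
pose h (mt : int * k.-tuple int) := [tuple of mt.1 :: mt.2].
pose P := [set mt | \sum_(m <- h mt) zexp m = e]%classic.
rewrite (@reindex_fsbig _ _ _ _ _ h P); last first.
  split=> [//|[m t] [m' t'] _ _ /(congr1 val) [-> /val_inj-> //]|t].
  by case/tupleP: t => m t te; exists (m, t).
rewrite [RHS]fsbig_mkcond; apply: eq_fsbigr => -[m t] _.
rewrite shifted_power0 /patch /=.
have -> : ((m, t) \in P) = (e - \sum_(i <- t) zexp i == zexp m).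
  by apply/idP/eqP; rewrite inE /P /= big_cons => H; lia.
by case: eqP => _; rewrite ?scale1r ?scale0r.
Qed.

(** The constant term z^-2 / 4 of the contraction: the two summands of
    (2z + eps) z^(-1/2) (z + eps)^(-1/2) eps^-2 contribute 2 * 3/8 and -1/2. *)
Lemma contraction0 d : contraction K 0 d = if d == -4 then 4^-1 else 0.
Proof.
rewrite /contraction /shifted_power !add0r /=.
have -> : (d - 1 == -1 - 2 * 2) = (d == -4) by lia.
have -> : (d + 1 == -1 - 2 * 1) = (d == -4) by lia.
case: eqP => _; last by rewrite mulr0 addr0.
rewrite /gbinom !big_ord_recl !big_ord0 /=.
rewrite -[(1 + 1)%N`!]/2%N -[1%N`!]/1%N.
by rewrite mulrN1z /bump /=; field.
Qed.

Lemma contraction_mul0 (A : opseries K) e p :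
  contraction_mul 0 A e p = 4^-1 *: zmul (-4) A e p.
Proof.
pose f d := contraction K 0 d *: A (e - d) p.
have -> : contraction_mul 0 A e p = \sum_(d \in [set (-4 : int)]%classic) f d.
  apply/esym; apply: fsbig_widen => // d [_ /= /eqP/negPf dN4].
  by rewrite /f contraction0 dN4 scale0r.
by rewrite fsbig_set1 /f contraction0 eqxx.
Qed.

Lemma wick0 k e p : wick (K := K) k 0 e p =
  xpow k.+1 e p + (k%:R / 4) *: zmul (-4) (xpow k.-1) e p.
Proof. by rewrite /wick xpow_shift0 contraction_mul0 scalerA. Qed.

(** Multiplication by x(z) gives a X, and its contraction with each of the k
    factors of X^k gives a derivative in X. Here 'X in {poly {poly K}} is X,
    and the inner 'X is z^-1. *)
Definition xhat_step (a : {poly {poly K}}) : {poly {poly K}} :=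
  a * 'X + (4^-1 *: 'X^2) *: a^`().

Lemma xhat_stepD : {morph xhat_step : a b / a + b}.
Proof. by move=> a b; rewrite /xhat_step mulrDl derivD scalerDr addrACA. Qed.

Lemma xhat_step_monomial (c : K) (j k : nat) :
  xhat_step ((c *: 'X^j) *: 'X^k) =
  (c *: 'X^j) *: 'X^(k.+1) + ((c * (k%:R / 4)) *: 'X^(j + 2)) *: 'X^(k.-1).
Proof.
have coefE : (4^-1 *: 'X^2) * (c *: 'X^j *+ k) =
    (c * (k%:R / 4)) *: 'X^(j + 2) :> {poly K}.
  rewrite scalerMnl -scalerAl -scalerAr -exprD scalerA addnC.
  by rewrite -mulr_natr; congr (_ *: _); ring.
rewrite /xhat_step -scalerAl -exprSr derivZ derivXn.
by rewrite -scalerMnr scalerMnl scalerA coefE.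
Qed.

Lemma xhat_mul0 a : xhat_mul a 0 = zcomb (xhat_step a) (xpow (K := K)).
Proof.
apply/funext => e; apply/funext => p.
move: a; apply: additive_bipoly_ext => [a b|a b|c j k].
- exact: zcombD.
- by rewrite xhat_stepD zcombD.
rewrite /xhat_mul zcomb_monomial {1}/zmul wick0 xhat_step_monomial zcombD.
rewrite zcomb_monomial scalerDr; congr (_ + _).
rewrite zcomb_monomial -[in RHS]scalerA /zmul.
by have -> : e - - (2 * j%:Z) - -4 = e - - (2 * (j + 2)%N%:Z) by lia.
Qed.

(** * Normally ordered powers are linearly independent *)

Lemma pderiv1 k : pderiv k (1 : fock K) = 0.
Proof.
rewrite /pderiv big1 // => m _; rewrite mcoeff1.
by case: eqP => [->|_]; rewrite ?cm1 ?mul0rn monalgU0.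
Qed.

Lemma beta0 m : beta m (0 : fock K) = 0.
Proof.
case: m => k /=; last by rewrite mulr0 scaler0.
by rewrite /pderiv big1 // => m _; rewrite mcoeff0 mul0rn monalgU0.
Qed.

Lemma nord_annihilates_vacuum (t : seq int) :
  ~~ all (< 0) t -> nord t (1 : fock K) = 0.
Proof.
move=> t_ge0; rewrite /nord foldr_cat.
have : has (fun m => 0 <= m) t.
  by move: t_ge0; rewrite -has_predC; apply: sub_has => m /=; rewrite leNgt.
(* The rightmost annihilator is the first to act on 1. *)
rewrite has_filter.
case/lastP: [seq _ <- _ | _] (filter_all (>= 0) t) => // s m.
rewrite all_rcons => /andP[m_ge0 _] _; rewrite foldr_rcons.
have -> : beta m 1 = 0 :> fock K by case: m m_ge0 => // k _; exact: pderiv1.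
have foldr0 r : foldr (@beta K) 0 r = 0 :> fock K.
  by elim: r => //= i r ->; exact: beta0.
by rewrite !foldr0.
Qed.

(** The mode [Negz k] creates u_k, and k = |Negz k| - 1. *)
Definition creation_monomial (t : seq int) : cmonom nat :=
  foldr (fun m => mmul (ucm `|m|%N.-1)) mone t.

Lemma creation_monomialE t i : all (< 0) t ->
  creation_monomial t i = count_mem (Negz i) t.
Proof.
elim: t => [|m t IHt] /=; first by rewrite cm1.
by case: m => // k; rewrite /= => t_lt0; rewrite cmM cmU IHt.
Qed.

Lemma uvar_mul_monomial k (m : cmonom nat) (x : K) :
  uvar K k * mkmalgU m x = mkmalgU (mmul (ucm k) m) x.
Proof. by rewrite malgM_def /uvar fgmulUU mul1r. Qed.

Lemma scale_monomial c (m : cmonom nat) (x : K) :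
  c *: mkmalgU m x = mkmalgU m (c * x).
Proof. by rewrite -mul_malgC malgM_def fgmulUU mul1m. Qed.

Lemma nord_creators (t : seq int) : all (< 0) t ->
  nord t (1 : fock K) =
  mkmalgU (creation_monomial t) (\prod_(m <- t) (2 * `|m|.-1 + 1)%:R).
Proof.
move=> t_lt0; rewrite /nord (all_filterP t_lt0).
have -> : [seq m <- t | 0 <= m] = [::].
  apply/eqP; rewrite -[_ == _]negbK -has_filter; apply/hasPn => m.
  by move=> /(allP t_lt0); rewrite /= -ltNge.
rewrite cats0; elim: t t_lt0 => [|m t IHt] /=.
  by rewrite big_nil.
case: m => [//|k] /= t_lt0.
by rewrite (IHt t_lt0) big_cons uvar_mul_monomial scale_monomial.
Qed.

(** The mode [Negz 0] creates u_0, with coefficient 1. *)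
Definition u0_power k := creation_monomial (nseq k (Negz 0)).

(** Only a product of k modes that all create u_0 reaches u_0^k from 1: each
    creator multiplies by its own variable, so the monomial of a product of
    creators determines the creators, with multiplicities. *)
Lemma mcoeff_nord_vacuum (t : seq int) k :
  mcoeff (u0_power k) (nord t (1 : fock K)) = (t == nseq k (Negz 0))%:R.
Proof.
have nseq_lt0 : all (< 0) (nseq k (Negz 0)) by rewrite all_nseq orbT.
have [t_lt0|t_ge0] := boolP (all (< 0) t); last first.
  rewrite nord_annihilates_vacuum // mcoeff0.
  by case: eqP t_ge0 => // ->; rewrite nseq_lt0.
rewrite nord_creators // mcoeffU.
have [->|t_neq] := eqVneq t.
  by rewrite eqxx big1_seq // => m /andP[_ /nseqP[-> _]].
case: eqP => // /(congr1 (fun m : cmonom nat => m : nat -> nat)) eq_mon.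
case/eqP: t_neq; have count_t i : count_mem (Negz i) t = ((i == 0) * k)%N.
  rewrite -creation_monomialE // eq_mon creation_monomialE // count_nseq.
  by case: i.
have t_pred1 : all (pred1 (Negz 0)) t.
  apply/allP => m mt /=; case: m mt (allP t_lt0 _ mt) => // -[|i] // mt _.
  by move: mt; rewrite -has_pred1 has_count count_t.
have <- : size t = k by move: t_pred1; rewrite all_count count_t mul1n => /eqP.
exact/all_pred1P.
Qed.

(** A sum with infinite support is 0 by convention, and so is its
    coefficient. *)
Lemma mcoeff_fsbig (I : choiceType) (D : set I) (F : I -> fock K) m :
  (forall i, D i -> mcoeff m (F i) = 0) ->
  mcoeff m (\sum_(i \in D) F i) = 0.
Proof.
move=> F0; rewrite raddf_sum big1_seq // => i /andP[_].
case: finite_supportP => //= X XD _ _ Xi; exact/F0/XD.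
Qed.

Lemma sum_zexp_nseq k : \sum_(m <- nseq k (Negz 0)) zexp m = - k%:Z.
Proof. by elim: k => [|k IHk]; rewrite ?big_nil //= big_cons IHk /zexp; lia. Qed.

(** Among the tuples of l modes, only the k-fold repetition of the mode
    creating u_0 contributes to u_0^k, and it contributes to z^(-k/2). *)
Lemma mcoeff_xpow_vacuum k l e :
  mcoeff (u0_power k) (xpow l e (1 : fock K)) =
  if (l == k) && (e == - k%:Z) then (-1) ^+ k else 0.
Proof.
rewrite /xpow mcoeffZ; case: andP => [[/eqP-> /eqP->]|lke]; last first.
  rewrite mcoeff_fsbig ?mulr0 // => t te; rewrite mcoeff_nord_vacuum.
  case: eqP => // tE; case: lke; split.
    by rewrite -(size_tuple t) tE size_nseq.
  by rewrite -te /= tE sum_zexp_nseq.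
(* For z^(-k/2) the sum over tuples reduces to one term already before taking
   coefficients: the modes of a nonzero term are creators, whose [zexp] is at
   least -1, with equality only for the mode creating u_0. *)
pose t0 := [tuple of nseq k (Negz 0)].
rewrite -(@fsbig_widen _ _ _ _ [set t0]%classic).
- by rewrite fsbig_set1 mcoeff_nord_vacuum eqxx mulr1.
- by move=> _ ->; exact: sum_zexp_nseq.
move=> t [/= te tN].
have [t_lt0|t_ge0] := boolP (all (< 0) t); last first.
  by rewrite nord_annihilates_vacuum.
case: tN; apply/val_inj => /=.
have exp_ge0 (m : int) : (m \in (t : seq int)) && true -> 0 <= zexp m + 1.
  by rewrite andbT => /(allP t_lt0) /=; rewrite /zexp; lia.
have sum_exp0 : \sum_(m <- t) (zexp m + 1) = 0.
  rewrite big_split /= te big_const_seq count_predT size_tuple iter_addr_0.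
  by rewrite natz addNr.
have /all_pred1P-> : all (pred1 (Negz 0)) t.
  apply/allP => m mt /=; apply/eqP.
  move/eqP: sum_exp0; rewrite big_seq_cond psumr_eq0 // => /allP/(_ _ mt).
  by rewrite mt /zexp /= => /eqP; lia.
by rewrite size_tuple.
Qed.

(** Applying a(z) to the vacuum reads off the coefficients of a, one at a
    time. *)
Lemma mcoeff_zcomb_xpow_vacuum (a : {poly {poly K}}) k j :
  mcoeff (u0_power k) (zcomb a (@xpow K) (- k%:Z - 2 * j%:Z) (1 : fock K)) =
  (-1) ^+ k * a`_k`_j.
Proof.
move: a; apply: additive_bipoly_ext => [a b|a b|c i l].
- by rewrite zcombD mcoeffD.
- by rewrite !coefD mulrDr.
rewrite zcomb_monomial mcoeffZ mcoeff_xpow_vacuum !coefZ !coefXn.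
rewrite eq_sym; case: eqP => [->|_]; last by rewrite /= !mulr0 coef0 mulr0.
rewrite mulr1 coefZ coefXn.
have -> : (- l%:Z - 2 * j%:Z - - (2 * i%:Z) == - l%:Z) = (j == i) by lia.
by case: eqP => _; rewrite ?mulr1 ?mulr0 // mulrC.
Qed.

Lemma zcomb_xpow_inj : injective (fun a => zcomb a (xpow (K := K))).
Proof.
move=> a b eq_ab; apply/polyP => k; apply/polyP => j.
have /mulfI : (-1) ^+ k != 0 :> K by rewrite expf_neq0 // oppr_eq0 oner_eq0.
by apply; rewrite -!mcoeff_zcomb_xpow_vacuum eq_ab.
Qed.

(** * The regularized powers *)

(** The coefficient n! / (j! 2^j (n-2j)! 4^j) of the theorem, written with a
    falling factorial: it vanishes by itself for 2j > n, so sums over j may be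
    extended past n/2. *)
Definition regpow_coef n j : K := (n ^_ (2 * j))%:R / (j`!%:R * 8 ^+ j).

Lemma regpow_coef0 n : regpow_coef n 0 = 1.
Proof. by rewrite /regpow_coef ffactn0 fact0 mulr1 divr1. Qed.

Lemma regpow_coef_small n j : (n < 2 * j)%N -> regpow_coef n j = 0.
Proof. by move=> nj; rewrite /regpow_coef ffact_small // mul0r. Qed.

(** The two terms are the contributions of a X and (z^-2 / 4) a' to the
    coefficient of z^-(2j+2) X^(n-2j-1) in [xhat_step]. *)
Lemma regpow_coefS n j : regpow_coef n.+1 j.+1 =
  regpow_coef n j.+1 + (n - 2 * j)%:R / 4 * regpow_coef n j.
Proof.
have ffactS m : (n.+1 ^_ m.+1 = n ^_ m.+1 + m.+1 * n ^_ m)%N.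
  rewrite ffactSS ffactnSr; case: (leqP m n) => [mn|nm]; first by nia.
  by rewrite ffact_small // !muln0.
have fact_neq0 : (j`!%:R != 0 :> K) by rewrite pnatr_eq0 -lt0n fact_gt0.
have exp8_neq0 : (8 ^+ j != 0 :> K) by rewrite expf_neq0 // pnatr_eq0.
have jS_neq0 : (j.+1%:R != 0 :> K) by rewrite pnatr_eq0.
rewrite /regpow_coef mulnS ffactS natrD mulrDl; congr (_ + _).
rewrite ffactnSr factS exprS !natrM.
have -> : (2 * j).+2%:R = 2 * j.+1%:R :> K by rewrite -natrM mulnS.
by field; rewrite exp8_neq0 fact_neq0 addrC natr1 jS_neq0.
Qed.

(** A rescaled Hermite polynomial in X, homogeneous of degree n when z^-1 and X
    have degree 1. *)
Definition regpow n : {poly {poly K}} :=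
  \sum_(j < n.+1) (regpow_coef n j *: 'X^(2 * j)) *: 'X^(n - 2 * j).

Lemma regpow0 : regpow 0 = 1.
Proof. by rewrite /regpow big_ord1 regpow_coef0 !scale1r. Qed.

Lemma regpowS n : regpow n.+1 = xhat_step (regpow n).
Proof.
rewrite /regpow (additive_sum _ _ xhat_stepD).
rewrite [RHS](eq_bigr _ (fun j _ => xhat_step_monomial _ _ _)) big_split /=.
(* The sum coming from a X, to be shifted by one to meet the one coming from
   a'; its additional last term has coefficient 0. *)
pose raised j : {poly {poly K}} :=
  (regpow_coef n j *: 'X^(2 * j)) *: 'X^((n - 2 * j).+1).
have -> : \sum_(j < n.+1) raised j = raised 0%N + \sum_(j < n.+1) raised j.+1.
  transitivity (\sum_(j < n.+2) raised j); last by rewrite big_ord_recl.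
  rewrite [RHS]big_ord_recr /= [raised n.+1]/raised.
  by rewrite regpow_coef_small ?scale0r ?addr0 //; lia.
rewrite big_ord_recl -addrA; congr (_ + _).
  by rewrite /raised !regpow_coef0 !subn0.
rewrite -big_split; apply: eq_bigr => j _.
rewrite lift0 /= regpow_coefS scalerDl scalerDl /raised; congr (_ + _).
  have [jn|nj] := leqP (2 * j.+1) n; first by rewrite subSn.
  by rewrite regpow_coef_small // !scale0r.
rewrite mulrC mulnS addnC.
by congr (_ *: 'X^_); lia.
Qed.

(** From left to right this is the uniqueness of the regularized power. There
    the induction meets an arbitrary expression of the previous power as a
    combination of normally ordered powers, which [zcomb_xpow_inj] identifies
    with [regpow]. *)
Lemma xhat_odotP n A : (0 < n)%N ->
  xhat_odot n A <-> A = zcomb (regpow n) (xpow (K := K)).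
Proof.
move=> n_gt0; have xhatE : @xhat K = zcomb (regpow 1) (xpow (K := K)).
  rewrite regpowS regpow0 /xhat_step -polyC1 derivC scaler0 addr0 polyC1 mul1r.
  have -> : 'X = (1 *: 'X^0) *: 'X^1 :> {poly {poly K}} by rewrite !scale1r.
  apply/funext => e; apply/funext => p; rewrite -xpow1.
  by rewrite zcomb_monomial scale1r /zmul subr0.
split=> [|->].
  elim=> [//|{n_gt0}m {}A B _ -> [a [eq_a ->]]].
  by rewrite xhat_mul0 regpowS (zcomb_xpow_inj eq_a).
elim: n n_gt0 => // -[_ _|n IHn _]; first by rewrite -xhatE; exact: xhat_odot1.
apply: xhat_odotS (IHn isT) _; exists (regpow n.+1); split=> //.
by rewrite xhat_mul0 -regpowS.
Qed.

Lemma regpow_coefE n j : (2 * j <= n)%N -> regpow_coef n j =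
  (j`!%:R)^-1 * (n`!%:R / (2 ^+ j * (n - 2 * j)`!%:R)) * (4 ^+ j)^-1.
Proof.
move=> jn; have fact_neq0 m : (m`!%:R != 0 :> K).
  by rewrite pnatr_eq0 -lt0n fact_gt0.
have exp_neq0 m : (m.+1%:R ^+ j != 0 :> K) by rewrite expf_neq0 // pnatr_eq0.
rewrite /regpow_coef -(ffact_fact jn) natrM.
have -> : 8 ^+ j = 2 ^+ j * 4 ^+ j :> K by rewrite -exprMn -natrM.
by field; rewrite !fact_neq0 !exp_neq0.
Qed.

Lemma zcomb_regpowE n (F : nat -> opseries K) e p :
  zcomb (regpow n) F e p =
  \sum_(j < (n./2).+1)
    ((j`!%:R)^-1 * (n`!%:R / (2 ^+ j * (n - 2 * j)`!%:R)) * (4 ^+ j)^-1)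
      *: zmul (- (4 * j%:Z)) (F (n - 2 * j)%N) e p.
Proof.
rewrite (additive_sum _ _ (zcombD F e p)).
under eq_bigr do rewrite zcomb_monomial.
pose term j := regpow_coef n j *: zmul (- (4 * j%:Z)) (F (n - 2 * j)%N) e p.
transitivity (\sum_(j < n.+1) term j).
  by apply: eq_bigr => j _; rewrite PoszM mulrA.
transitivity (\sum_(j < n./2.+1) term j); last first.
  apply: eq_bigr => j _; rewrite /term regpow_coefE //.
  by have := ltn_ord j; lia.
rewrite [RHS](big_ord_widen n.+1 term) ?[RHS]big_mkcond; last by lia.
apply: eq_bigr => j _; case: ifP => // /negbT nj.
by rewrite /term regpow_coef_small ?scale0r //; lia.
Qed.

End RegularizedPowers.

Theorem theorem8p1 (R : realType) (n : nat) (hn : (1 <= n)%N)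
    (A : opseries R[i]) :
  xhat_odot n A <->
  A = (fun (e : int) (p : fock R[i]) =>
    \sum_(j < (n./2).+1)
      ((j`!%:R)^-1 * (n`!%:R / (2 ^+ j * (n - 2 * j)`!%:R)) * (4 ^+ j)^-1)
        *: zmul (- (4 * j%:Z)) (xpow (K := R[i]) (n - 2 * j)) e p).
Proof.
rewrite xhat_odotP //.
by split=> ->; apply/funext => e; apply/funext => p; rewrite zcomb_regpowE.
Qed.
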